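(* Let $(M,J,g)$ be an almost anti-Hermitian manifold. If $(M,J,g)$ is an anti-Kähler-Codazzi manifold, then it is an anti-Kähler manifold, i.e. the Levi Civita connection $\nabla^{\mathrm g}$ of $g$ and the tensor field $J$ satisfy $\nabla^{\mathrm g}J=0$. Therefore, there are no strict anti-Kähler-Codazzi manifolds (anti-Kähler-Codazzi manifolds with $\nabla^{\mathrm g}J\neq0$).
   Context: $M$ is a smooth manifold of dimension $2n$, $\mathfrak{X}(M)$ is the set of vector fields on $M$, and $Id$ is the identity tensor field. $(M,J,g)$ is an almost anti-Hermitian (almost Norden) manifold if $J$ is a $(1,1)$-tensor field and $g$ is a semi-Riemannian metric of signature $(n,n)$ such that $J^2=-Id$ and $g(JX,JY)=-g(X,Y)$ for all $X,Y\in\mathfrak{X}(M)$. Its twin metric is the semi-Riemannian metric $\widetilde g(X,Y)=g(JX,Y)$. Let $\nabla^{\mathrm g}$ be the Levi Civita connection of $g$. An almost anti-Hermitian manifold is called an anti-Kähler-Codazzi manifold if it satisfies the Codazzi equation $$(\nabla^{\mathrm g}_X\widetilde g)(Y,Z)-(\nabla^{\mathrm g}_Y\widetilde g)(X,Z)=0,\quad\forall X,Y,Z\in\mathfrak{X}(M),$$ which is equivalent to $(\nabla^{\mathrm g}_XJ)Y-(\nabla^{\mathrm g}_YJ)X=0$ for all $X,Y\in\mathfrak{X}(M)$. It is called anti-Kähler if $\nabla^{\mathrm g}J=0$. *)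

(* Defs.v *)
From HB Require Import structures.
From mathcomp Require Import all_boot all_order all_algebra.
From mathcomp Require Import sesquilinear.
From mathcomp Require Import all_classical all_reals all_analysis.

Set Implicit Arguments.
Unset Strict Implicit.
Unset Printing Implicit Defensive.

Import Order.TTheory GRing.Theory Num.Theory.
Import numFieldNormedType.Exports.

Local Open Scope classical_set_scope.
Local Open Scope ring_scope.

(** * Smooth functions on open sets *)

(* C^k on U, for U open: Frechet differentiable on U, with all directional
   derivatives of class C^(k-1) on U. *)
Fixpoint Ck_on (R : realType) (V W : normedModType R) (k : nat)
    (U : set V) (f : V -> W) : Prop :=
  match k with
  | 0 => forall x, U x -> {for x, continuous f}
  | k'.+1 => (forall x, U x -> differentiable f x)
             /\ forall v : V, Ck_on k' U (fun x => 'd f x v)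
  end.

Definition smooth_on (R : realType) (V W : normedModType R)
    (U : set V) (f : V -> W) : Prop :=
  forall k, Ck_on k U f.

(** * Smooth manifolds *)

(* [chart_map] and [chart_inv] are total functions; their values outside
   [chart_dom] and [chart_cod], respectively, are irrelevant. *)
Record chart (R : realType) (m : nat) (T : topologicalType) := Chart {
  chart_dom : set T ;
  chart_map : T -> 'rV[R]_m ;
  chart_inv : 'rV[R]_m -> T ;
  chart_open_dom : open chart_dom ;
  chart_open_cod : open (chart_map @` chart_dom) ;
  chart_mapK : forall p, chart_dom p -> chart_inv (chart_map p) = p ;
  chart_map_continuous :
    forall p, chart_dom p -> {for p, continuous chart_map} ;
  chart_inv_continuous :
    forall x, (chart_map @` chart_dom) x -> {for x, continuous chart_inv}
}.

Definition chart_cod (R : realType) (m : nat) (T : topologicalType)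
  (c : chart R m T) : set 'rV[R]_m := chart_map c @` chart_dom c.

(* The smooth structure is the one generated by [atlas], which need not be
   maximal.  [chart_at p] is a preferred chart around [p]; any choice will do,
   it only serves to give the tangent space at [p] a concrete model. *)
Record manifold (R : realType) (m : nat) := Manifold {
  carrier :> topologicalType ;
  manifold_hausdorff : hausdorff_space carrier ;
  manifold_second_countable : @second_countable carrier ;
  atlas : set (chart R m carrier) ;
  chart_at : carrier -> chart R m carrier ;
  chart_at_atlas : forall p, atlas (chart_at p) ;
  chart_at_dom : forall p, chart_dom (chart_at p) p ;
  atlas_compatible : forall c d, atlas c -> atlas d ->
    smooth_on (chart_map c @` (chart_dom c `&` chart_dom d))
              (chart_map d \o chart_inv c)
}.

Section Fields.
Context {R : realType} {m : nat} {M : manifold R m}.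

(* The tangent space at [p] is modelled on R^m: a tangent vector is given by
   its components with respect to the chart [chart_at M p]. *)
Definition tangent (p : M) := 'rV[R]_m.

(* Components, with respect to the chart [c], of a tangent vector at [p]. *)
Definition components (c : chart R m M) (p : M) (v : tangent p) : 'rV[R]_m :=
  'd (chart_map c \o chart_inv (chart_at p)) (chart_map (chart_at p) p) v.

Definition smooth_fun (f : M -> R) : Prop :=
  forall c, atlas c -> smooth_on (chart_cod c) (f \o chart_inv c : _ -> R^o).

Definition field := forall p : M, tangent p.

Definition smooth_field (X : field) : Prop :=
  forall c, atlas c ->
    smooth_on (chart_cod c)
      (fun x => components c (p := chart_inv c x) (X (chart_inv c x))).

(* The function X(f). *)
Definition lie_deriv (X : field) (f : M -> R) (p : M) : R :=
  'd (f \o chart_inv (chart_at p) : _ -> R^o) (chart_map (chart_at p) p) (X p).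

(* Z = [X, Y] *)
Definition is_lie_bracket (X Y Z : field) : Prop :=
  smooth_field Z /\
  forall f, smooth_fun f -> forall p,
    lie_deriv Z f p = lie_deriv X (lie_deriv Y f) p
                      - lie_deriv Y (lie_deriv X f) p.

(** * Tensor fields *)

Definition endo_field := forall p : M, {linear 'rV[R]_m -> 'rV[R]_m}.

Definition form_field := forall p : M, {biscalar 'rV[R]_m}.

Definition app_endo (J : endo_field) (X : field) : field := fun p => J p (X p).

Definition app_form (b : forall p : M, tangent p -> tangent p -> R)
  (X Y : field) : M -> R := fun p => b p (X p) (Y p).

(* Smoothness of a tensor field is tested on smooth vector fields. *)
Definition smooth_endo (J : endo_field) : Prop :=
  forall X, smooth_field X -> smooth_field (app_endo J X).

Definition smooth_form (b : form_field) : Prop :=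
  forall X Y, smooth_field X -> smooth_field Y -> smooth_fun (app_form b X Y).

(* The form [b] has signature (k, m - k): it admits an orthonormal basis (the
   rows of B) with k vectors of square 1 followed by m - k of square -1. *)
Definition has_signature (k : nat) (b : {biscalar 'rV[R]_m}) : Prop :=
  exists2 B : 'M[R]_m, B \in unitmx &
    forall i j : 'I_m, b (row i B) (row j B) =
      if i == j then (if (i < k)%N then 1 else -1) else 0.

Record semi_riemannian (k : nat) (g : form_field) : Prop := SemiRiemannian {
  metric_smooth : smooth_form g ;
  metric_sym : forall p (v w : tangent p), g p v w = g p w v ;
  metric_nondegenerate :
    forall p (v : tangent p), (forall w : tangent p, g p v w = 0) -> v = 0 ;
  metric_signature : forall p, has_signature k (g p)
}.

(** * Connections *)

(* A connection is an operator on all sections, but its axioms only constrain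
   it on smooth vector fields. *)
Record affine_connection (nabla : field -> field -> field) : Prop :=
  AffineConnection {
  nabla_smooth : forall X Y, smooth_field X -> smooth_field Y ->
    smooth_field (nabla X Y) ;
  nabla_addl : forall X X' Y,
    smooth_field X -> smooth_field X' -> smooth_field Y ->
    forall p, nabla (fun q => X q + X' q) Y p = nabla X Y p + nabla X' Y p ;
  nabla_scalel : forall f X Y,
    smooth_fun f -> smooth_field X -> smooth_field Y ->
    forall p, nabla (fun q => f q *: X q) Y p = f p *: nabla X Y p ;
  nabla_addr : forall X Y Y',
    smooth_field X -> smooth_field Y -> smooth_field Y' ->
    forall p, nabla X (fun q => Y q + Y' q) p = nabla X Y p + nabla X Y' p ;
  nabla_leibniz : forall f X Y,
    smooth_fun f -> smooth_field X -> smooth_field Y ->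
    forall p, nabla X (fun q => f q *: Y q) p
              = lie_deriv X f p *: Y p + f p *: nabla X Y p
}.

Definition torsion_free (nabla : field -> field -> field) : Prop :=
  forall X Y, smooth_field X -> smooth_field Y ->
    is_lie_bracket X Y (fun p => nabla X Y p - nabla Y X p).

(* (nabla_X b)(Y, Z) *)
Definition nabla_form (nabla : field -> field -> field)
    (b : forall p : M, tangent p -> tangent p -> R)
    (X Y Z : field) (p : M) : R :=
  lie_deriv X (app_form b Y Z) p
  - app_form b (nabla X Y) Z p - app_form b Y (nabla X Z) p.

(* (nabla_X J) Y *)
Definition nabla_endo (nabla : field -> field -> field) (J : endo_field)
    (X Y : field) : field :=
  fun p => nabla X (app_endo J Y) p - J p (nabla X Y p).

Record levi_civita (g : form_field) (nabla : field -> field -> field) : Prop :=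
  LeviCivita {
  lc_connection : affine_connection nabla ;
  lc_torsion_free : torsion_free nabla ;
  lc_metric : forall X Y Z,
    smooth_field X -> smooth_field Y -> smooth_field Z ->
    forall p, nabla_form nabla g X Y Z p = 0
}.

Definition parallel_endo (nabla : field -> field -> field) (J : endo_field)
  : Prop :=
  forall X Y, smooth_field X -> smooth_field Y ->
    forall p, nabla_endo nabla J X Y p = 0.

(** * Almost anti-Hermitian manifolds *)

Definition twin (J : endo_field) (g : form_field) (p : M) (v w : tangent p)
  : R := g p (J p v) w.

(* [nabla] stands for the Levi-Civita connection of [g]. *)
Definition codazzi (J : endo_field) (g : form_field)
    (nabla : field -> field -> field) : Prop :=
  forall X Y Z, smooth_field X -> smooth_field Y -> smooth_field Z ->
    forall p, nabla_form nabla (twin J g) X Y Z p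
              - nabla_form nabla (twin J g) Y X Z p = 0.

End Fields.

Arguments field {R m} M.
Arguments endo_field {R m} M.
Arguments form_field {R m} M.

Record almost_anti_hermitian (R : realType) (n : nat) (M : manifold R n.*2)
    (J : endo_field M) (g : form_field M) : Prop := AlmostAntiHermitian {
  aah_smooth : smooth_endo J ;
  aah_metric : semi_riemannian n g ;
  aah_square : forall p (v : tangent p), J p (J p v) = - v ;
  aah_compatible : forall X Y : field M, smooth_field X -> smooth_field Y ->
    forall p, app_form g (app_endo J X) (app_endo J Y) p = - app_form g X Y p
}.

Definition anti_kahler_codazzi (R : realType) (n : nat) (M : manifold R n.*2)
    (J : endo_field M) (g : form_field M)
    (nabla : field M -> field M -> field M) : Prop :=
  [/\ almost_anti_hermitian J g, levi_civita g nabla & codazzi J g nabla].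

Definition anti_kahler (R : realType) (n : nat) (M : manifold R n.*2)
    (J : endo_field M) (g : form_field M)
    (nabla : field M -> field M -> field M) : Prop :=
  [/\ almost_anti_hermitian J g, levi_civita g nabla & parallel_endo nabla J].

Definition strict_anti_kahler_codazzi (R : realType) (n : nat)
    (M : manifold R n.*2) (J : endo_field M) (g : form_field M)
    (nabla : field M -> field M -> field M) : Prop :=
  anti_kahler_codazzi J g nabla /\ ~ parallel_endo nabla J.

(* Main.v *)
Require Import Defs.
From HB Require Import structures.
From mathcomp Require Import all_boot all_order all_algebra.
From mathcomp Require Import all_classical all_reals all_analysis.
From mathcomp Require Import ring lra.

(** Put A(X, Y) = (nabla_X J) Y and T(X, Y, Z) = g(A(X, Y), Z).  Compatibility
    makes each J_p self-adjoint for g, and nabla is metric, so T(X, Y, Z) is the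
    covariant derivative of the twin metric ([nabla_form_twin]).  Hence T is
    symmetric in Y and Z, and the Codazzi equation says that it is symmetric in
    X and Y: it is totally symmetric.  Differentiating J^2 = -Id gives
    A(X, J Y) = - J A(X, Y), that is T(X, JY, Z) = - T(X, Y, JZ): moving J from
    one of the last two slots to the other changes the sign, hence by total
    symmetry so does moving J between any two slots.  Going round the three
    slots takes three moves, so

      T(JX, Y, Z) = - T(X, JY, Z) = T(X, Y, JZ) = - T(JX, Y, Z),

    which forces T(JX, Y, Z) = 0.  As J is invertible, T vanishes
    ([codazzi_nabla_form_twin0]).

    Everything above is a statement on smooth vector fields, while
    nondegeneracy of g at p quantifies over all tangent vectors at p.  The
    analytic part of the proof bridges this gap: every tangent vector is the
    value of a globally smooth field ([smooth_field_extension]).  A constant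
    field in a chart is multiplied by a bump function supported in a compact
    ball inside the chart and extended by zero.  The support is compact, hence
    closed in M by the Hausdorff property, and so the extension is smooth at
    the points outside the chart.  This needs the closure of C^k maps under
    sums, products and composition, and a smooth function that vanishes exactly
    on the nonpositive reals ([flat]). *)

Set Implicit Arguments.
Unset Strict Implicit.
Unset Printing Implicit Defensive.
Import Order.TTheory GRing.Theory Num.Theory.
Import numFieldNormedType.Exports.
Local Open Scope classical_set_scope.
Local Open Scope ring_scope.

(** * Locality and product rule for differentials *)

Section DiffGerm.
Context {R : realType} {V W : normedModType R}.

(** The first-order expansion of f at x is also one of g, because littleo only
    depends on the germ; uniqueness of the differential does the rest. *)
Lemma near_eq_diff_spec (f g : V -> W) (x : V) :
  (\forall y \near x, f y = g y) -> differentiable f x ->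
  is_diff x g ('d f x).
Proof.
move=> fg /[dup] df /diff_locallyP[dc dl].
have H : g \o shift x = cst (g x) + 'd f x +o_ 0 id.
  apply/eqaddoP => e e0; move/eqaddoP: dl => /(_ e e0) dl.
  have fg0 : \forall y \near 0, f (y + x) = g (y + x).
    by have := fg; rewrite (near_shift 0) /=; apply: filterS => y; rewrite subr0.
  near=> y.
  have E1 : f x = g x by exact: nbhs_singleton fg.
  have E2 : f (y + x) = g (y + x) by near: y.
  have : `|(f \o shift x - (cst (f x) + 'd f x)) y| <= e * `|y| by near: y.
  by rewrite !fctE /= E1 E2.
have E := diff_unique dc H.
apply: DiffDef; last exact: E.
by apply/diff_locallyP; split; rewrite E; [exact: dc|exact: H].
Unshelve. all: by end_near. Qed.

Lemma near_eq_differentiable (f g : V -> W) (x : V) :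
  (\forall y \near x, f y = g y) -> differentiable f x -> differentiable g x.
Proof. by move=> fg df; case: (near_eq_diff_spec fg df). Qed.

Lemma near_eq_diff (f g : V -> W) (x : V) :
  (\forall y \near x, f y = g y) -> differentiable f x ->
  'd g x = 'd f x :> (V -> W).
Proof. by move=> fg df; case: (near_eq_diff_spec fg df). Qed.

(** Chain rule for the pair (f, g) followed by the bilinear map (a, w) |-> aw. *)
Lemma is_diff_scale (f : V -> R^o) (g : V -> W) (x : V) :
  differentiable f x -> differentiable g x ->
  is_diff x (fun y => f y *: g y) (fun v => 'd f x v *: g x + f x *: 'd g x v).
Proof.
move=> df dg.
pose s : R^o -> W -> W := fun a w => a *: w.
have sb : bilinear_for (GRing.Scale.Law.clone _ _ *:%R _)
    (GRing.Scale.Law.clone _ _ *:%R _) s.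
  split => [?|?] a u v; rewrite /s /=.
    by rewrite scalerDl scalerA.
  by rewrite scalerDr !scalerA mulrC.
pose sM := bilinear_isBilinear.Build R R^o W W _ _ s sb.
pose B : {bilinear R^o -> W -> W} := HB.pack s sM.
have Bc : continuous (fun p : R^o * W => B p.1 p.2).
  by move=> p; exact: scale_continuous.
have h : (fun y => f y *: g y)
  = (fun p : R^o * W => B p.1 p.2) \o (fun y => (f y, g y)) by [].
have dp := differentiable_pair df dg.
have db := @differentiable_bilin _ _ _ _ B (f x, g x) Bc.
rewrite h; apply: DiffDef; first exact: differentiable_comp.
rewrite diff_comp// diff_bilin// diff_pair//.
by apply/funext => v; exact: addrC.
Qed.

End DiffGerm.

(** * Calculus of C^k maps *)

Section CkCalculus.
Context {R : realType}.
Implicit Types (V W Y : normedModType R) (k : nat).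

(** The conditions defining [Ck_on] are tested at one point of U at a time, so
    the sets A need neither be open nor be contained in U. *)
Lemma Ck_on_local V W k (U : set V) (f : V -> W) :
  (forall x, U x -> exists2 A : set V, A x & Ck_on k A f) -> Ck_on k U f.
Proof.
elim: k f => [|k IH] f H /=.
  by move=> x /H[A Ax]; exact.
split; first by move=> x /H[A Ax] [+ _]; exact.
by move=> v; apply: IH => x /H[A Ax] [_ dA]; exists A => //; exact: dA.
Qed.

Lemma Ck_on_sub V W k (A U : set V) (f : V -> W) :
  A `<=` U -> Ck_on k U f -> Ck_on k A f.
Proof. by move=> AU fU; apply: Ck_on_local => x /AU; exists U. Qed.

(** Here U must be open: the differential at a point depends on the values of
    the map in a neighbourhood. *)
Lemma Ck_on_ext V W k (U : set V) (f g : V -> W) :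
  open U -> (forall x, U x -> f x = g x) -> Ck_on k U f -> Ck_on k U g.
Proof.
move=> oU; elim: k f g => [|k IH] f g fg /= Hf.
  move=> x Ux; have fgx : \forall y \near x, f y = g y.
    by apply: filterS (open_nbhs_nbhs (conj oU Ux)) => y; exact: fg.
  rewrite /prop_for /continuous_at -(fg x Ux).
  by apply: cvg_trans (Hf x Ux); apply: near_eq_cvg.
case: Hf => df dfC.
have fgx x : U x -> \forall y \near x, f y = g y.
  by move=> Ux; apply: filterS (open_nbhs_nbhs (conj oU Ux)) => y; exact: fg.
split=> [x Ux|v]; first exact: near_eq_differentiable (fgx x Ux) (df x Ux).
apply: IH (dfC v) => x Ux.
by rewrite (near_eq_diff (fgx x Ux) (df x Ux)).
Qed.

Lemma Ck_onS V W k (U : set V) (f : V -> W) : Ck_on k.+1 U f -> Ck_on k U f.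
Proof.
elim: k f => [|k IH] f [df dfC]; last by split=> // v; exact: IH.
by move=> x Ux; apply: differentiable_continuous; exact: df.
Qed.

Lemma Ck_on_cst V W k (U : set V) (w : W) : Ck_on k U (fun _ : V => w).
Proof.
elim: k w => [|k IH] w /=; first by move=> x _; exact: cst_continuous.
split=> [x _|v]; first exact: differentiable_cst.
rewrite (_ : (fun x => _) = (fun _ => 0)); first exact: IH.
by apply/funext => x; rewrite (diff_cst _ x).
Qed.

Lemma Ck_on_linear V W k (U : set V) (l : {linear V -> W}) :
  continuous l -> Ck_on k U l.
Proof.
case: k => [|k] lc /=; first by move=> x _; exact: lc.
split=> [x _|v]; first exact: linear_differentiable.
rewrite (_ : (fun x => _) = (fun _ => l v)); first exact: Ck_on_cst.
by apply/funext => x; rewrite diff_lin.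
Qed.

Lemma Ck_on_add V W k (U : set V) (f g : V -> W) : open U ->
  Ck_on k U f -> Ck_on k U g -> Ck_on k U (fun x => f x + g x).
Proof.
move=> oU; elim: k f g => [|k IH] f g /=.
  by move=> fc gc x Ux; apply: (@continuousD _ _ _ f g); [exact: fc|exact: gc].
move=> [df dfC] [dg dgC]; split=> [x Ux|v].
  by apply: (@differentiableD _ _ _ f g); [exact: df|exact: dg].
apply: Ck_on_ext (IH _ _ (dfC v) (dgC v)) => // x Ux.
exact/esym/(congr1 (fun h : V -> W => h v) (diffD (df x Ux) (dg x Ux))).
Qed.

Lemma Ck_on_sum V W k (U : set V) d (f : 'I_d -> V -> W) : open U ->
  (forall i, Ck_on k U (f i)) -> Ck_on k U (fun x => \sum_i f i x).
Proof.
move=> oU; elim: d f => [|d IH] f fC.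
  rewrite (_ : (fun x => _) = (fun _ => 0)); first exact: Ck_on_cst.
  by apply/funext => x; rewrite big_ord0.
rewrite (_ : (fun x => _) = (fun x => f ord0 x + \sum_i f (lift ord0 i) x)).
  by apply: Ck_on_add => //; exact: IH.
by apply/funext => x; rewrite big_ord_recl.
Qed.

Lemma Ck_on_scale V W k (U : set V) (f : V -> R^o) (g : V -> W) : open U ->
  Ck_on k U f -> Ck_on k U g -> Ck_on k U (fun x => f x *: g x).
Proof.
move=> oU; elim: k f g => [|k IH] f g.
  move=> /= fc gc x Ux; apply: (@continuousZ _ _ _ f g); [exact: fc|exact: gc].
move=> fC gC; have [df dfC] := fC; have [dg dgC] := gC; split=> [x Ux|v].
  by case: (is_diff_scale (df x Ux) (dg x Ux)).
apply: (@Ck_on_ext _ _ _ _ (fun x => 'd f x v *: g x + f x *: 'd g x v)) => //.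
  move=> x Ux; have [_ E] := is_diff_scale (df x Ux) (dg x Ux).
  exact/esym/(congr1 (fun h : V -> W => h v) E).
apply: (Ck_on_add oU); apply: IH.
- exact: dfC.
- exact: Ck_onS gC.
- exact: Ck_onS fC.
- exact: dgC.
Qed.

Lemma Ck_on_comp_linear V W W' k (U : set V) (l : {linear W -> W'}) (f : V -> W) :
  open U -> continuous l -> Ck_on k U f -> Ck_on k U (l \o f).
Proof.
move=> oU lc; elim: k f => [|k IH] f /=.
  by move=> fc x Ux; apply: continuous_comp; [exact: fc|exact: lc].
move=> [df dfC]; have dl y : differentiable l y by exact: linear_differentiable.
split=> [x Ux|v]; first by apply: differentiable_comp => //; exact: df.
apply: Ck_on_ext (IH _ (dfC v)) => // x Ux.
by rewrite (diff_comp (df x Ux) (dl (f x))) diff_lin.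
Qed.

(** The derivative of g o f along v is the value at 'd f x v of a linear map that
    also varies with x.  To stay with derivatives in fixed directions, 'd f x v
    is expanded on the finite basis e, with coordinate forms l; this turns it
    into a sum of products, to which induction on k applies. *)
Lemma Ck_on_comp V Y W d (e : 'I_d -> Y) (l : 'I_d -> {linear Y -> R^o})
    k (U : set V) (A : set Y) (f : V -> Y) (g : Y -> W) :
  (forall i, continuous (l i)) -> (forall y, y = \sum_i l i y *: e i) ->
  open U -> (forall x, U x -> A (f x)) ->
  Ck_on k U f -> Ck_on k A g -> Ck_on k U (g \o f).
Proof.
move=> lc yE oU UA; elim: k g => [|k IH] g.
  move=> /= fc gc x Ux; apply: continuous_comp; first exact: fc.
  exact/gc/UA.
move=> fC [dg dgC]; have [df dfC] := fC; split=> [x Ux|v].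
  by apply: differentiable_comp; [exact: df|exact/dg/UA].
apply: (@Ck_on_ext _ _ _ _
  (fun x => \sum_i l i ('d f x v) *: 'd g (f x) (e i))) => //.
  move=> x Ux; rewrite (diff_comp (df x Ux) (dg _ (UA x Ux))).
  rewrite /= [in RHS](yE ('d f x v)) linear_sum.
  by apply: eq_bigr => i _; rewrite linearZ.
apply: (Ck_on_sum oU) => i; apply: (Ck_on_scale oU).
  exact: (Ck_on_comp_linear oU (lc i) (dfC v)).
by apply: (IH (fun y => 'd g y (e i))); [exact: Ck_onS fC|exact: dgC].
Qed.

End CkCalculus.

(** * A flat function on the line *)

Section Flat.
Context {R : realType}.

(** The functions x^(-n) exp(-1/x), extended by zero.  The powers of 1/x are
    there because the derivative of the n-th function is a combination of the
    next two, so that smoothness of the whole family is one induction. *)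
Definition flat (n : nat) (x : R^o) : R^o :=
  if 0 < x then x^-1 ^+ n * expR (- x^-1) else 0.

(** Since exp(1/x) is at least a multiple of x^(-n-2).  A quadratic bound is what
    gives a zero derivative at 0. *)
Lemma flat_le n (x : R) : `|flat n x| <= (n.+2)`!%:R * x ^+ 2.
Proof.
rewrite /flat; case: ifPn => [x0|_]; last by rewrite normr0 mulr_ge0 ?sqr_ge0.
have y0 : 0 <= x^-1 by rewrite invr_ge0 ltW.
rewrite ger0_norm ?mulr_ge0 ?exprn_ge0 ?expR_ge0// expRN ler_pdivrMr ?expR_gt0//.
set F := (n.+2`!%:R : R); have F0 : 0 < F by rewrite ltr0n fact_gt0.
have H : x^-1 ^+ n.+2 <= F * expR x^-1.
  rewrite -ler_pdivrMl// mulrC; apply: le_trans (expR_ge1Dxn n.+1 y0).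
  by rewrite lerDr.
have -> : x^-1 ^+ n = x ^+ 2 * x^-1 ^+ n.+2.
  by rewrite -(addn2 n) exprD mulrCA -exprMn divff ?gt_eqF// expr1n mulr1.
by rewrite (mulrC F) -[leRHS]mulrA; apply: ler_wpM2l; rewrite ?sqr_ge0.
Qed.

Lemma flat_diff n (x : R^o) :
  is_diff x (flat n) (fun v : R^o => v *: (flat n.+2 x - n%:R * flat n.+1 x)).
Proof.
suff dx : is_derive x (1:R) (flat n) (flat n.+2 x - n%:R * flat n.+1 x).
  have df : differentiable (flat n) x by apply/derivable1_diffP; case: dx.
  apply: DiffDef => //; rewrite diff1E//.
  by apply/funext => v; rewrite derive1E; case: dx => _ ->.
have [x0|x0|x0] := ltgtP x 0.
- have f0 (y : R) : y <= 0 -> forall m, flat m y = 0.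
    by move=> y0 m; rewrite /flat ltNge y0.
  rewrite !f0 ?ltW// mulr0 subr0.
  apply: (@near_eq_is_derive _ _ _ (fun=> 0)).
  near=> y; rewrite f0//; apply: ltW; near: y; exact: lt_nbhsl.
- have y0 : x != 0 by rewrite gt_eqF.
  apply: (@near_eq_is_derive _ _ _ (fun y : R => y^-1 ^+ n * expR (- y^-1))).
    near=> y; rewrite /flat ifT//; near: y; exact: lt_nbhsr.
  pose q (y : R) : R := y^-1.
  have dV : is_derive x (1:R) q (- x ^- 2).
    have := @is_deriveV R id x 1 1 y0 (is_derive_id _ _).
    by rewrite [_ *: 1]mulr1.
  have dE : is_derive x (1:R) (expR \o (- q)) (expR (- x^-1) * - - x ^- 2).
    exact: is_derive1_comp.
  have dP : is_derive x (1:R) (q ^+ n) ((n%:R * q x ^+ n.-1) *: - x ^- 2).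
    exact: is_deriveX.
  have -> : (fun y : R => y^-1 ^+ n * expR (- y^-1)) = q ^+ n * (expR \o (- q)).
    by apply/funext => y; rewrite exprfctE.
  apply: is_derive_eq (is_deriveM dP dE) _.
  rewrite exprfctE /= /flat x0 /q opprK -!exprVn /GRing.scale /=.
  case: (n) => [|m]; first by rewrite !expr0 !exprS expr0 /=; ring.
  by rewrite !exprS expr0 /=; ring.
(* At 0 the difference quotient is bounded by a multiple of |h|. *)
- rewrite x0 /flat ltxx mulr0 subr0.
  have c0 : h^-1 *: (flat n (h *: (1:R) + 0) - flat n 0) @[h --> (0:R)^'] --> (0:R).
    apply/(@cvgr0Pnorm_le _ R^o) => e e0.
    set F := (n.+2`!%:R : R); have F0 : 0 < F by rewrite ltr0n fact_gt0.
    near=> h; have h0 : h != 0 by near: h; exact: nbhs_dnbhs_neq.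
    have hF : `|h| <= e / F.
      near: h; apply: (@dnbhs0_le R R^o); exact: divr_gt0.
    rewrite [in X in _ - X]/flat ltxx subr0 addr0 [h *: 1]mulr1.
    rewrite normrM normfV ler_pdivrMl ?normr_gt0// mulrC.
    apply: le_trans (flat_le n h) _.
    rewrite -[h ^+ 2]ger0_norm ?sqr_ge0// normrX expr2 mulrA ler_wpM2r//.
    by rewrite mulrC -ler_pdivlMr.
  apply: DeriveDef; first by apply: cvgP c0.
  by apply: cvg_lim c0.
Unshelve. all: by end_near. Qed.

Lemma flat_smooth n (U : set R^o) : smooth_on U (flat n).
Proof.
move=> k; apply: (@Ck_on_sub _ _ _ _ _ setT) => //.
elim: k n => [|k IH] n /=.
  by move=> x _; apply: differentiable_continuous; case: (flat_diff n x).
split=> [x _|v]; first by case: (flat_diff n x).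
have oT : open [set: R^o] by exact: openT.
apply: (@Ck_on_ext _ _ _ _ _
  (fun x => v *: flat n.+2 x + (- (v * n%:R)) *: flat n.+1 x)) => //.
  move=> x _; case: (flat_diff n x) => _ ->.
  by rewrite /GRing.scale/=; ring.
by apply: (Ck_on_add oT); apply: (Ck_on_scale oT); [exact: Ck_on_cst|exact: IH|exact: Ck_on_cst|exact: IH].
Qed.

End Flat.

(** * Coordinates *)

Section Coordinates.
Context {R : realType}.

Definition rV_coord m (i : 'I_m) (v : 'rV[R]_m) : R^o := v ord0 i.

Fact rV_coord_linear m (i : 'I_m) : linear (rV_coord i).
Proof. by move=> a u v; rewrite /rV_coord !mxE. Qed.

HB.instance Definition _ m (i : 'I_m) :=
  GRing.isLinear.Build R 'rV[R]_m R^o *:%R (rV_coord i) (rV_coord_linear i).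

Lemma rV_coord_continuous m (i : 'I_m) : continuous (rV_coord i).
Proof. by move=> v; exact: coord_continuous. Qed.

Lemma Ck_on_comp_rV (V W : normedModType R) m k (U : set V) (A : set 'rV[R]_m)
    (f : V -> 'rV[R]_m) (g : 'rV[R]_m -> W) :
  open U -> (forall x, U x -> A (f x)) ->
  Ck_on k U f -> Ck_on k A g -> Ck_on k U (g \o f).
Proof.
apply: (@Ck_on_comp _ _ _ _ _ (fun i => delta_mx ord0 i)
  (fun i => rV_coord i : {linear _ -> _})).
  exact: rV_coord_continuous.
exact: row_sum_delta.
Qed.

Lemma Ck_on_comp_R (V W : normedModType R) k (U : set V) (A : set R^o)
    (f : V -> R^o) (g : R^o -> W) :
  open U -> (forall x, U x -> A (f x)) ->
  Ck_on k U f -> Ck_on k A g -> Ck_on k U (g \o f).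
Proof.
pose l (_ : 'I_1) : {linear R^o -> R^o} := idfun.
apply: (@Ck_on_comp R V R^o W 1 (fun=> 1) l).
  by move=> i x; exact: cvg_id.
by move=> y; rewrite big_ord1 [RHS]mulr1.
Qed.

End Coordinates.

(** * Bump functions *)

Section Bump.
Context {R : realType}.

(** This is exp(-1/(r^2 - |x - a|^2)) for the Euclidean norm, on the Euclidean
    ball of radius r.  The sum of squares is written with scalings so that its
    smoothness is an instance of the product rule above. *)
Definition bump_fun m (a : 'rV[R]_m) (r : R) (x : 'rV[R]_m) : R^o :=
  flat 0 (r ^+ 2 + \sum_i (- (rV_coord i x - rV_coord i a))
                          *: (rV_coord i x - rV_coord i a)).

Lemma bump_smooth m (a : 'rV[R]_m) r (U : set 'rV[R]_m) :
  smooth_on U (bump_fun a r).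
Proof.
move=> k; apply: (@Ck_on_sub _ _ _ _ _ setT) => //.
have oT := openT : open [set: 'rV[R]_m].
have lin i : Ck_on k [set: 'rV[R]_m] (fun x => rV_coord i x - rV_coord i a).
  apply: (Ck_on_add oT); last exact: Ck_on_cst.
  by apply: (@Ck_on_linear _ _ _ _ _ (rV_coord i)); exact: rV_coord_continuous.
apply: (@Ck_on_comp_R _ _ _ _ _ setT _ (flat 0) oT) => //; last exact: flat_smooth.
apply: (Ck_on_add oT); first exact: Ck_on_cst.
apply: (Ck_on_sum oT) => i; apply: (Ck_on_scale oT); last exact: lin.
apply: (@Ck_on_ext _ _ _ _ _
  (fun x => (-1 : R^o) *: (rV_coord i x - rV_coord i a))) => //.
  by move=> x _; rewrite scaleN1r.
by apply: (Ck_on_scale oT); [exact: Ck_on_cst|exact: lin].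
Qed.

Lemma bump_center m (a : 'rV[R]_m) r : 0 < r -> bump_fun a r a != 0.
Proof.
move=> r0; rewrite /bump_fun big1 => [|i _]; last by rewrite subrr scaler0.
by rewrite addr0 /flat exprn_gt0// expr0 mul1r gt_eqF// expR_gt0.
Qed.

(** The norm on row vectors is the sup norm, which the Euclidean norm dominates. *)
Lemma bump_support m (a : 'rV[R]_m) r x :
  0 < r -> bump_fun a r x != 0 -> `|a - x| <= r.
Proof.
move=> r0; rewrite /bump_fun /flat; case: ifPn => [+ _|]; last by rewrite eqxx.
set s := \sum_i _ => H.
rewrite -[leLHS]/(mx_norm (a - x)).
have [->|/mx_norm_neq0[[i j] /= E]] := eqVneq (mx_norm (a - x)) 0.
  exact: ltW.
rewrite E -ler_sqr ?nnegrE ?normr_ge0 ?(ltW r0)// real_normK ?num_real//.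
have {}H : - s <= r ^+ 2 by rewrite -subr_ge0 opprK ltW.
apply: le_trans H; rewrite /s -sumrN (bigD1 j)//= !mxE ord1 /rV_coord.
rewrite -scaleNr opprK -opprB sqrrN -[_ *: _]/(_ * _) -expr2 lerDl.
by apply: sumr_ge0 => k _; rewrite -scaleNr opprK; exact: sqr_ge0.
Qed.

Lemma closed_ball_compact m (a : 'rV[R]_m) r : 0 < r -> compact (closed_ball a r).
Proof.
move=> r0; apply: bounded_closed_compact; last exact: closed_ball_closed.
exists (`|a| + r); split; first exact: num_real.
move=> s rs x; rewrite closed_ballE// /closed_ball_ /= => ax.
apply: le_trans (ltW rs); rewrite -(subrK a x) addrC.
by rewrite (le_trans (ler_normD _ _))// lerD2l distrC.
Qed.

End Bump.

(** * Extension of tangent vectors to smooth fields *)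

Section Transition.
Context {R : realType} {m : nat} {M : manifold R m}.
Implicit Types (c d : chart R m M) (p q : M) (w : 'rV[R]_m).

(** As [chart_inv] is only continuous on the image of the chart, the preimage
    of A has to be cut down to it. *)
Lemma chart_inv_open c (A : set M) :
  open A -> open (chart_cod c `&` chart_inv c @^-1` A).
Proof.
move=> oA; rewrite openE => x [cx Ax].
apply: filterI; first exact: (open_nbhs_nbhs (conj (@chart_open_cod _ _ _ c) cx)).
exact: (chart_inv_continuous cx) (open_nbhs_nbhs (conj oA Ax)).
Qed.

Lemma transition_domainE c d :
  chart_map c @` (chart_dom c `&` chart_dom d)
  = chart_cod c `&` chart_inv c @^-1` chart_dom d.
Proof.
apply/seteqP; split=> [_ [q [cq dq] <-]|_ [[q cq <-]]].
  by split; [exists q|rewrite /= chart_mapK].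
by rewrite /= chart_mapK// => dq; exists q.
Qed.

Lemma transition_domain_open c d :
  open (chart_map c @` (chart_dom c `&` chart_dom d)).
Proof.
by rewrite transition_domainE; exact/chart_inv_open/chart_open_dom.
Qed.

Lemma transition_differentiable c d p :
  atlas c -> atlas d -> chart_dom c p -> chart_dom d p ->
  differentiable (chart_map d \o chart_inv c) (chart_map c p).
Proof.
move=> ac ad cp dp.
by have [dT _] := atlas_compatible ac ad 1%N; apply: dT; exists p.
Qed.

(** The chain rule; it makes the components of a tangent vector independent of
    the auxiliary chart a. *)
Lemma transition_diff_comp a c d p w :
  atlas a -> atlas c -> atlas d ->
  chart_dom a p -> chart_dom c p -> chart_dom d p ->
  'd (chart_map d \o chart_inv a) (chart_map a p)
    ('d (chart_map a \o chart_inv c) (chart_map c p) w)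
  = 'd (chart_map d \o chart_inv c) (chart_map c p) w.
Proof.
move=> aa ac ad ap cp dp.
pose f := chart_map a \o chart_inv c; pose g := chart_map d \o chart_inv a.
have df : differentiable f (chart_map c p) by exact: transition_differentiable.
have fp : f (chart_map c p) = chart_map a p by rewrite /f /= chart_mapK.
have dg : differentiable g (f (chart_map c p)).
  by rewrite fp; exact: transition_differentiable.
have near_fg : \forall y \near chart_map c p,
    (g \o f) y = (chart_map d \o chart_inv c) y.
  have : open_nbhs (chart_map c p) (chart_map c @` (chart_dom c `&` chart_dom a)).
    by split; [exact: transition_domain_open|exists p].
  move=> /open_nbhs_nbhs; apply: filterS => _ [q [cq aq] <-].
  by rewrite /g /f /= !chart_mapK.
have dgf := differentiable_comp df dg.
have E := etrans (near_eq_diff near_fg dgf) (diff_comp df dg).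
have := congr1 (fun h : 'rV[R]_m -> 'rV[R]_m => h w) E.
by rewrite /= fp.
Qed.

(** The field with components phi * w in the chart c, extended by zero.  The
    differential converts these components to those with respect to
    [chart_at q], in which tangent vectors at q are expressed. *)
Definition chart_field c (phi : 'rV[R]_m -> R^o) w : field M := fun q =>
  if pselect (chart_dom c q) then
    phi (chart_map c q)
      *: 'd (chart_map (chart_at q) \o chart_inv c) (chart_map c q) w
  else 0.

Lemma chart_field_components c d phi w q : atlas c -> atlas d ->
  chart_dom c q -> chart_dom d q ->
  components d (chart_field c phi w q)
  = phi (chart_map c q) *: 'd (chart_map d \o chart_inv c) (chart_map c q) w.
Proof.
move=> ac ad cq dq; rewrite /components /chart_field; case: pselect => [?|//].
have E := transition_diff_comp w (chart_at_atlas q) ac ad (chart_at_dom q) cq dq.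
pose L : {linear 'rV[R]_m -> 'rV[R]_m} :=
  'd (chart_map d \o chart_inv (chart_at q)) (chart_map (chart_at q) q).
exact: (etrans (linearZZ L _ _) (congr1 (GRing.scale _) E)).
Qed.

(** Around a point of the chart domain the components are those of a product
    composed with a transition map.  Around any other point the field is zero,
    because the image of K in M is compact, hence closed, and does not contain
    that point. *)
Lemma chart_field_smooth c phi w (K : set 'rV[R]_m) : atlas c ->
  smooth_on (chart_cod c) phi -> K `<=` chart_cod c -> compact K ->
  (forall x, ~ K x -> phi x = 0) -> smooth_field (chart_field c phi w).
Proof.
move=> ac phiC Kc cK phi0 d ad k.
pose K' := chart_inv c @` K.
have K'closed : closed K'.
  apply: compact_closed; first exact: manifold_hausdorff.
  apply: continuous_compact cK; apply: continuous_in_subspaceT => x.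
  by rewrite inE => /Kc; exact: chart_inv_continuous.
apply: Ck_on_local => x dx.
have [cx|ncx] := pselect (chart_dom c (chart_inv d x)).
  exists (chart_map d @` (chart_dom d `&` chart_dom c)).
    by rewrite transition_domainE; split.
  have oU := @transition_domain_open d c.
  pose F y := phi y *: 'd (chart_map d \o chart_inv c) y w.
  apply: (@Ck_on_ext _ _ _ _ _ (F \o (chart_map c \o chart_inv d))) => //.
    move=> _ [q [dq cq] <-]; rewrite /F /= chart_mapK//.
    exact/esym/chart_field_components.
  apply: (@Ck_on_comp_rV _ _ _ _ _ _
      (chart_map c @` (chart_dom c `&` chart_dom d)) _ F oU).
  - by move=> _ [q [dq cq] <-]; exists q; rewrite //= chart_mapK.
  - exact: atlas_compatible.
  - have oV := @transition_domain_open c d.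
    apply: (Ck_on_scale oV).
      by apply: Ck_on_sub (phiC k); rewrite transition_domainE => ? [].
    by have [_] := atlas_compatible ac ad k.+1; exact.
have nKx : ~ K' (chart_inv d x).
  move=> [y Ky E]; apply: ncx; rewrite -E.
  by have [q cq <-] := Kc _ Ky; rewrite chart_mapK.
exists (chart_cod d `&` chart_inv d @^-1` (~` K')); first by split.
apply: (@Ck_on_ext _ _ _ _ _ (fun=> 0)); last exact: Ck_on_cst.
  exact/chart_inv_open/closed_openC.
move=> y [_ nKy]; rewrite /chart_field; case: pselect => [cy|?].
  rewrite phi0 ?scale0r /components ?linear0// => Ky; apply: nKy.
  by exists (chart_map c (chart_inv d y)) => //; rewrite chart_mapK.
by rewrite /components linear0.
Qed.

(** The bump function need not be 1 at its centre, so w is divided by its value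
    there. *)
Lemma smooth_field_extension p (w : tangent p) :
  exists2 Z : field M, smooth_field Z & Z p = w.
Proof.
pose c := chart_at p; pose a := chart_map c p.
have ac : atlas c := chart_at_atlas p; have cp : chart_dom c p := chart_at_dom p.
have cod_a : open_nbhs a (chart_cod c).
  by split; [exact: chart_open_cod|exists p].
have [r rc] := (nbhs_closedballP _ _).1 (open_nbhs_nbhs cod_a).
have r0 : 0 < r%:num by [].
exists (chart_field c (bump_fun a r%:num) ((bump_fun a r%:num a)^-1 *: w)).
  apply: (@chart_field_smooth _ _ _ (closed_ball a r%:num)) => //.
  - exact: bump_smooth.
  - exact: closed_ball_compact.
  - move=> x; apply: contra_notP => /eqP b0; rewrite closed_ballE//.
    exact: bump_support b0.
rewrite /chart_field; case: pselect => [?|//]; rewrite -/c -/a.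
have near_id : \forall y \near a, idfun y = (chart_map c \o chart_inv c) y.
  by apply: filterS (open_nbhs_nbhs cod_a) => _ [q cq <-]; rewrite /= chart_mapK.
have di : differentiable (idfun : 'rV[R]_m -> _) a by [].
have idE := diff_lin a (fun x : 'rV[R]_m => cvg_id : {for x, continuous idfun}).
set v := _^-1 *: w.
have E := congr1 (fun h : 'rV[R]_m -> 'rV[R]_m => h v)
  (etrans (near_eq_diff near_id di) idE).
apply: etrans (congr1 (GRing.scale _) E) _.
by rewrite /v scalerA divff ?scale1r// bump_center.
Qed.

End Transition.

(** * Parallelism of J *)

Section SmoothFieldOps.
Context {R : realType} {m : nat} {M : manifold R m}.

Lemma smooth_fun_cst (a : R) : smooth_fun (fun _ : M => a).
Proof. by move=> c _ k; exact: Ck_on_cst. Qed.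

Lemma lie_deriv_cst (X : field M) (a : R) p : lie_deriv X (fun=> a) p = 0.
Proof.
by have -> : lie_deriv X (fun=> a) p
  = 'd (cst a : _ -> R^o) (chart_map (chart_at p) p) (X p) by []; rewrite diff_cst.
Qed.

(** The axioms of a connection apply to smooth fields only; the Leibniz rule for
    the constant function -1 involves no field other than X and Y. *)
Lemma nabla_opp (nabla : field M -> field M -> field M) (X Y : field M) p :
  affine_connection nabla -> smooth_field X -> smooth_field Y ->
  nabla X (fun q => - Y q) p = - nabla X Y p.
Proof.
move=> nablaP sX sY.
have -> : (fun q => - Y q) = (fun q => (-1 : R) *: Y q) :> field M.
  by apply/functional_extensionality_dep => q; rewrite scaleN1r.
rewrite (nabla_leibniz nablaP (smooth_fun_cst (-1)))//.
by rewrite lie_deriv_cst scale0r add0r scaleN1r.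
Qed.

End SmoothFieldOps.

Section Kahler.
Context {R : realType} {n : nat} {M : manifold R n.*2}.
Context {J : endo_field M} {g : form_field M}.
Context {nabla : field M -> field M -> field M}.
Context (JgP : almost_anti_hermitian J g) (nablaP : levi_civita g nabla).

Let sJ X : smooth_field X -> smooth_field (app_endo J X).
Proof. exact: (aah_smooth JgP). Qed.

Let gC p (v w : tangent p) : g p v w = g p w v.
Proof. exact: (Defs.metric_sym (aah_metric JgP)). Qed.

(** Compatibility applied to JX and Y, with J^2 = -Id.  It is a property of
    smooth fields; extending v and w makes it pointwise. *)
Lemma J_selfadjoint p (v w : tangent p) : g p (J p v) w = g p v (J p w).
Proof.
have [X sX <-] := smooth_field_extension v.
have [Y sY <-] := smooth_field_extension w.
have := aah_compatible JgP (sJ sX) sY p.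
rewrite /app_form /app_endo (aah_square JgP) linearNl => /oppr_inj.
by move=> ->.
Qed.

(** Metricity of nabla, applied to JY and Z, expands the derivative of g(JY, Z)
    that occurs in the left-hand side. *)
Lemma nabla_form_twin X Y Z p :
  smooth_field X -> smooth_field Y -> smooth_field Z ->
  nabla_form nabla (twin J g) X Y Z p = g p (nabla_endo nabla J X Y p) (Z p).
Proof.
move=> sX sY sZ; have := lc_metric nablaP sX (sJ sY) sZ p.
rewrite /nabla_form /nabla_endo /twin linearBl /app_form /app_endo /=.
(* Metricity says that an expression is 0; adding the right-hand side of the
   goal to that expression gives the left-hand side. *)
by move=> /(congr1 (+%R^~ (g p (nabla X (app_endo J Y) p) (Z p)
  - g p (J p (nabla X Y p)) (Z p)))); rewrite add0r => <-; ring.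
Qed.

Lemma nabla_form_twin_sym X Y Z p :
  smooth_field X -> smooth_field Y -> smooth_field Z ->
  nabla_form nabla (twin J g) X Y Z p = nabla_form nabla (twin J g) X Z Y p.
Proof.
move=> sX sY sZ; rewrite /nabla_form.
have -> : app_form (twin J g) Y Z = app_form (twin J g) Z Y.
  by apply/funext => q; rewrite /app_form /twin J_selfadjoint gC.
rewrite addrAC; congr (_ - _ - _); rewrite /app_form /twin.
  by rewrite J_selfadjoint gC.
by rewrite J_selfadjoint gC.
Qed.

(** Obtained by differentiating J^2 = -Id. *)
Lemma nabla_endo_J X Y p : smooth_field X -> smooth_field Y ->
  nabla_endo nabla J X (app_endo J Y) p = - J p (nabla_endo nabla J X Y p).
Proof.
move=> sX sY; rewrite /nabla_endo linearB /= (aah_square JgP) opprB.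
have -> : app_endo J (app_endo J Y) = (fun q => - Y q).
  by apply/functional_extensionality_dep => q; exact: (aah_square JgP).
by rewrite (nabla_opp p (lc_connection nablaP)) // addrC opprK.
Qed.

Lemma nabla_form_twin_J X Y Z p :
  smooth_field X -> smooth_field Y -> smooth_field Z ->
  nabla_form nabla (twin J g) X (app_endo J Y) Z p
  = - nabla_form nabla (twin J g) X Y (app_endo J Z) p.
Proof.
move=> sX sY sZ; rewrite nabla_form_twin//; last exact: sJ.
rewrite nabla_form_twin//; last exact: sJ.
by rewrite nabla_endo_J// linearNl J_selfadjoint.
Qed.

(** JX can be moved to the last slot directly, which changes the sign
    ([TJ1]), or through the middle one, which does not. *)
Lemma codazzi_nabla_form_twin0 : codazzi J g nabla ->
  forall X Y Z p, smooth_field X -> smooth_field Y -> smooth_field Z ->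
  nabla_form nabla (twin J g) X Y (app_endo J Z) p = 0.
Proof.
move=> cod.
pose T := nabla_form nabla (twin J g).
have T12 X Y Z p : smooth_field X -> smooth_field Y -> smooth_field Z ->
    T X Y Z p = T Y X Z p.
  by move=> sX sY sZ; apply/eqP; rewrite -subr_eq0; apply/eqP; exact: cod.
have T23 X Y Z p : smooth_field X -> smooth_field Y -> smooth_field Z ->
    T X Y Z p = T X Z Y p := @nabla_form_twin_sym X Y Z p.
have TJ X Y Z p : smooth_field X -> smooth_field Y -> smooth_field Z ->
    T X (app_endo J Y) Z p = - T X Y (app_endo J Z) p :=
  @nabla_form_twin_J X Y Z p.
have TJ1 X Y Z p : smooth_field X -> smooth_field Y -> smooth_field Z ->
    T (app_endo J X) Y Z p = - T X Y (app_endo J Z) p.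
  move=> sX sY sZ; have sJX := sJ sX; have sJZ := sJ sZ.
  by rewrite (T12 _ _ _ _ sJX sY sZ) TJ// (T12 _ _ _ _ sY sX sJZ).
move=> X Y Z p sX sY sZ; have sJX := sJ sX; have sJY := sJ sY; have sJZ := sJ sZ.
have E1 := TJ1 X Y Z p sX sY sZ.
have E2 : T (app_endo J X) Y Z p = T X Y (app_endo J Z) p.
  by rewrite (T23 _ _ _ _ sJX sY sZ) TJ1// (T23 _ _ _ _ sX sZ sJY) TJ// opprK.
rewrite -/T; lra.
Qed.

Lemma codazzi_parallel : codazzi J g nabla -> parallel_endo nabla J.
Proof.
move=> cod X Y sX sY p; apply: (metric_nondegenerate (aah_metric JgP)) => w.
have [Z sZ <-] := smooth_field_extension w.
have sJZ := sJ sZ; have := codazzi_nabla_form_twin0 cod p sX sY sJZ.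
rewrite nabla_form_twin//; last exact: sJ.
by rewrite /app_endo (aah_square JgP) linearNr => /eqP; rewrite oppr_eq0 => /eqP.
Qed.

End Kahler.

Theorem corollary5p2 (R : realType) (n : nat) :
  (forall (M : manifold R n.*2) (J : endo_field M) (g : form_field M)
      (nabla : field M -> field M -> field M),
    almost_anti_hermitian J g -> levi_civita g nabla ->
    anti_kahler_codazzi J g nabla -> anti_kahler J g nabla)
  /\
  ~ (exists (M : manifold R n.*2) (J : endo_field M) (g : form_field M)
       (nabla : field M -> field M -> field M),
      strict_anti_kahler_codazzi J g nabla).
Proof.
split=> [M J g nabla JgP nablaP [_ _ cod]|].
  by split=> //; exact: codazzi_parallel JgP nablaP cod.
move=> [M [J [g [nabla [[JgP nablaP cod] npar]]]]].
exact: npar (codazzi_parallel JgP nablaP cod).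
Qed.
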